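(* Let $n\ge1$, let $a_{i,j},b_{i,j}>0$ for $0\le i\le n-1$, $j\in\mathbb Z$, and let $V=M_0\Psi M_2\Psi M_4\Psi\cdots M_{2n-2}\Psi$ and $G=VS^{-n}$. Let $$L^{(2)}=S^n\,\Psi Y_{n-1}^{[n-2]}\Psi\cdots Y_{n-1}^{[0]}\Psi\, S^{-n},\qquad U^{(2)}=M_0^{[0]}M_2^{[1]}\cdots M_{2n-2}^{[n-1]}S^{-n},$$ where the matrices $Y_{n-1}^{[j]}$ and $M_{2i}^{[j]}$ are obtained from the weights by the iteration described in the context. Then $L^{(2)}$ is lower triangular, $U^{(2)}$ is upper triangular, and $G=VS^{-n}=U^{(2)}L^{(2)}$.
   Context: All matrices are indexed by $\mathbb Z\times\mathbb Z$. $S$ is the shift, $S_{ij}=1$ if $i=j+1$ and $0$ otherwise; $\Psi=\sum_{k\ge0}S^k$; $D(\mathtt a)$ is the diagonal matrix with entries of $\mathtt a=(\mathtt a_j)_{j\in\mathbb Z}$; $\sigma^{-1}(\mathtt b)=(b_{j+1})_{j\in\mathbb Z}$. Write $\mathtt a_i=(a_{i,j})_j$, $\mathtt b_i=(b_{i,j})_j$ and $M_{2i}=D(\mathtt a_i)+D(\mathtt b_i)S$. Iteration: $(\mathtt a_i^{[0]},\mathtt b_i^{[0]})=(\mathtt a_i,\mathtt b_i)$ for $0\le i\le n-1$. For $j=1,\dots,n-1$ and $k\in\mathbb Z$: for $j+1\le i\le n-1$, $$a^{[j]}_{i,k}=a^{[j-1]}_{i,k}\frac{a^{[j-1]}_{i-1,k}+b^{[j-1]}_{i-1,k+1}}{a^{[j-1]}_{i,k}+b^{[j-1]}_{i,k+1}},\qquad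 b^{[j]}_{i,k}=b^{[j-1]}_{i,k+1}\frac{a^{[j-1]}_{i-1,k}+b^{[j-1]}_{i-1,k+1}}{a^{[j-1]}_{i,k}+b^{[j-1]}_{i,k+1}},$$ and for $i=j$, $$a^{[j]}_{j,k}=\frac{a^{[j-1]}_{j,k}}{a^{[j-1]}_{j,k}+b^{[j-1]}_{j,k+1}},\qquad b^{[j]}_{j,k}=\frac{b^{[j-1]}_{j,k+1}}{a^{[j-1]}_{j,k}+b^{[j-1]}_{j,k+1}}.$$ Set $M_{2i}^{[j]}=D(\mathtt a_i^{[j]})+D(\mathtt b_i^{[j]})S$ for $j\le i\le n-1$, and $Y_{i}^{[j-1]}=D(\mathtt a_{i}^{[j-1]}+\sigma^{-1}(\mathtt b_{i}^{[j-1]}))$ for $j\le i\le n-1$. (For $n=1$ the matrix $L^{(2)}$ is $S\Psi S^{-1}$.) *)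

(* Defs.v *)
From mathcomp Require Import all_boot all_order all_algebra finmap.
From mathcomp Require Import zify.
From mathcomp Require Import boolp classical_sets functions cardinality fsbigop.

Set Implicit Arguments.
Unset Strict Implicit.
Unset Printing Implicit Defensive.

Import Order.TTheory GRing.Theory Num.Theory.

Local Open Scope classical_set_scope.
Local Open Scope ring_scope.

Declare Scope zmx_scope.
Delimit Scope zmx_scope with Z2.

Section ZMatrices.
Variable R : realFieldType.

Definition zmx := int -> int -> R.

Definition zadd (A B : zmx) : zmx := fun i j => A i j + B i j.

(* The sum is a finitely supported one, and has the default value 0 when
   infinitely many terms are nonzero.  All the factors multiplied below are
   [lower_banded], for which [zmul_finite_support] shows that this default is
   never used, and [zmulA] that bracketing does not matter. *)
Definition zmul (A B : zmx) : zmx :=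
  fun i j => \sum_(k \in [set: int]) A i k * B k j.

Definition zid : zmx := fun i j => (i == j)%:R.

Definition zexp (A : zmx) (k : nat) : zmx := iter k (zmul A) zid.

Definition zdiag (d : int -> R) : zmx := fun i j => if i == j then d i else 0.

Definition lower_triangular (A : zmx) := forall i j : int, i < j -> A i j = 0.
Definition upper_triangular (A : zmx) := forall i j : int, j < i -> A i j = 0.

Definition zshift : zmx := fun i j => (i == j + 1)%:R.

(* S^-1, the transpose of S; see [zmul_shiftV] and [zmul_Vshift]. *)
Definition zshiftV : zmx := fun i j => zshift j i.

Definition zPsi : zmx :=
  fun i j => \sum_(k \in [set: nat]) zexp zshift k i j.

End ZMatrices.

Notation "A + B" := (zadd A B) : zmx_scope.
Notation "A * B" := (zmul A B) : zmx_scope.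
Notation "A ^+ k" := (zexp A k) : zmx_scope.

Section Iteration.
Variable R : realFieldType.

(* [(weights a b j).1 i k] is a^[j]_(i,k) and [(weights a b j).2 i k] is
   b^[j]_(i,k).  They are meaningful only for j <= i; the value 0 for i < j is
   never used. *)
Fixpoint weights (a b : nat -> int -> R) (j : nat) :
    (nat -> int -> R) * (nat -> int -> R) :=
  if j is j'.+1 then
    let A := (weights a b j').1 in
    let B := (weights a b j').2 in
    let den i k := A i k + B i (k + 1) in
    (fun i k => if (j < i)%N then A i k * (den i.-1 k / den i k)
                else if i == j then A i k / den i k else 0,
     fun i k => if (j < i)%N then B i (k + 1) * (den i.-1 k / den i k)
                else if i == j then B i (k + 1) / den i k else 0)
  else (a, b).

Definition sigmaV (b : int -> R) : int -> R := fun j => b (j + 1).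

(* [Mmx a b j i] is M_(2i)^[j]; in particular [Mmx a b 0 i] is M_(2i). *)
Definition Mmx (a b : nat -> int -> R) (j i : nat) : zmx R :=
  (zdiag ((weights a b j).1 i) + zdiag ((weights a b j).2 i) * @zshift R)%Z2.

(* [Ymx a b j i] is Y_i^[j]. *)
Definition Ymx (a b : nat -> int -> R) (j i : nat) : zmx R :=
  zdiag (fun k => (weights a b j).1 i k + sigmaV ((weights a b j).2 i) k).

Local Notation S := (@zshift R).
Local Notation SV := (@zshiftV R).
Local Notation Psi := (@zPsi R).

(* Ordered products, the factor of index 0 being the leftmost one. *)
Definition Vmx (n : nat) (a b : nat -> int -> R) : zmx R :=
  \big[@zmul R/@zid R]_(0 <= i < n) (Mmx a b 0 i * Psi)%Z2.

Definition Gmx (n : nat) (a b : nat -> int -> R) : zmx R :=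
  (Vmx n a b * SV ^+ n)%Z2.

(* The upper index of Y runs downwards from n-2 to 0. *)
Definition L2mx (n : nat) (a b : nat -> int -> R) : zmx R :=
  (S ^+ n *
   (Psi * \big[@zmul R/@zid R]_(0 <= k < n.-1) (Ymx a b (n - 2 - k) n.-1 * Psi)) *
   SV ^+ n)%Z2.

Definition U2mx (n : nat) (a b : nat -> int -> R) : zmx R :=
  ((\big[@zmul R/@zid R]_(0 <= i < n) Mmx a b i i) * SV ^+ n)%Z2.

End Iteration.

Section Banded.
Variable R : realFieldType.
Implicit Types (A B C : zmx R) (c d e : int).

Definition lower_banded c A := forall i j : int, i + c < j -> A i j = 0.

Lemma banded_term0 c d A B (i j k : int) :
  lower_banded c A -> lower_banded d B ->
  ~~ ((j - d <= k) && (k <= i + c)) -> A i k * B k j = 0.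
Proof.
move=> hA hB; rewrite negb_and -!ltNge => /orP[h|h].
  by rewrite hB ?mulr0//; lia.
by rewrite hA ?mul0r.
Qed.

Definition zrange (m : nat) : seq int := [seq k%:Z - m%:Z | k <- iota 0 (m.*2.+1)].

Lemma mem_zrange m (k : int) : (k \in zrange m) = (- m%:Z <= k <= m%:Z).
Proof.
apply/mapP/idP => [[l]|h]; first by rewrite mem_iota; lia.
by exists `|(k + m%:Z)%R|%N; rewrite ?mem_iota; lia.
Qed.

Lemma zrange_uniq m : uniq (zrange m).
Proof. by rewrite map_inj_uniq ?iota_uniq// => x y; lia. Qed.

Lemma zmul_finite_support c d A B (i j : int) :
  lower_banded c A -> lower_banded d B ->
  finite_set [set k : int | A i k * B k j != 0].
Proof.
move=> hA hB; pose m := (`|(j - d)%R| + `|(i + c)%R|)%N.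
apply: (@sub_finite_set _ _ [set` zrange m]); last exact: finite_seq.
move=> k /= /eqP h; rewrite mem_zrange; apply/negPn/negP => hk.
by apply: h; apply: (banded_term0 hA hB); move: hk; rewrite /m; lia.
Qed.

Lemma zmulE c d A B (i j : int) m :
  lower_banded c A -> lower_banded d B -> - m%:Z <= j - d -> i + c <= m%:Z ->
  (A * B)%Z2 i j = \sum_(k <- zrange m) A i k * B k j.
Proof.
move=> hA hB hm1 hm2; rewrite /zmul (fsbigE (zrange m) _ (zrange_uniq m))//.
  by under eq_bigl do rewrite in_setT.
move=> k _; rewrite mem_zrange => hr.
by apply: (banded_term0 hA hB); move: hr; lia.
Qed.

Lemma lower_banded_mul c d A B :
  lower_banded c A -> lower_banded d B -> lower_banded (c + d) (A * B)%Z2.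
Proof.
move=> hA hB i j hij; apply: fsbig1 => k _.
by apply: (banded_term0 hA hB); lia.
Qed.

Lemma zmulA c d e A B C :
  lower_banded c A -> lower_banded d B -> lower_banded e C ->
  (A * (B * C) = A * B * C)%Z2.
Proof.
move=> hA hB hC; apply/funext => i; apply/funext => j.
have hAB := lower_banded_mul hA hB; have hBC := lower_banded_mul hB hC.
pose m := (`|i| + `|j| + `|c| + `|d| + `|e|)%N.
rewrite (zmulE (m := m) hA hBC) ?(zmulE (m := m) hAB hC); try by rewrite /m; lia.
transitivity (\sum_(k <- zrange m) \sum_(l <- zrange m) A i k * B k l * C l j).
  apply: eq_bigr => k _; have [hk|hk] := leP k (i + c); last first.
    by rewrite hA// mul0r big1// => l _; rewrite !mul0r.
  rewrite (zmulE (m := m) hB hC); try by rewrite /m; lia.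
  by rewrite mulr_sumr; apply: eq_bigr => l _; rewrite mulrA.
rewrite exchange_big; apply: eq_bigr => l _.
have [hl|hl] := leP (j - e) l; last first.
  by rewrite hC ?mulr0 ?big1// => [k _|]; rewrite ?hC ?mulr0//; lia.
by rewrite (zmulE (m := m) hA hB) ?mulr_suml//; rewrite /m; lia.
Qed.

Lemma lower_banded_add c A B :
  lower_banded c A -> lower_banded c B -> lower_banded c (A + B)%Z2.
Proof. by move=> hA hB i j hij; rewrite /zadd hA// hB// addr0. Qed.

Lemma lower_banded_diag (f : int -> R) : lower_banded 0 (zdiag f).
Proof. by move=> i j hij; rewrite /zdiag; case: eqP => // hE; lia. Qed.

Lemma lower_banded_id : lower_banded 0 (@zid R).
Proof. by move=> i j hij; rewrite /zid; case: eqP => // hE; lia. Qed.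

Lemma lower_banded_exp c A k : lower_banded c A -> lower_banded (c *+ k) (A ^+ k)%Z2.
Proof.
move=> hA; elim: k => [|k IH]; first exact: lower_banded_id.
by rewrite mulrS; exact: lower_banded_mul.
Qed.

Lemma lower_banded_shift : lower_banded (-1) (@zshift R).
Proof. by move=> i j hij; rewrite /zshift; case: eqP => // hE; lia. Qed.

Lemma lower_banded_shiftV : lower_banded 1 (@zshiftV R).
Proof. by move=> i j hij; rewrite /zshiftV /zshift; case: eqP => // hE; lia. Qed.

Lemma zPsi_finite_support (i j : int) :
  finite_set [set k : nat | (@zshift R ^+ k)%Z2 i j != 0].
Proof.
apply: (@sub_finite_set _ _ `I_(`|i| + `|j|).+1); last exact: finite_II.
move=> k /= /eqP h; rewrite ltnNge; apply/negP => hk; apply: h.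
by have:= lower_banded_exp (k := k) lower_banded_shift; apply; rewrite mulNrn; lia.
Qed.

Lemma lower_banded_Psi : lower_banded 0 (@zPsi R).
Proof.
move=> i j hij; apply: fsbig1 => k _.
by have:= lower_banded_exp (k := k) lower_banded_shift; apply; rewrite mulNrn; lia.
Qed.

Lemma zmul_shiftV : (@zshift R * @zshiftV R)%Z2 = @zid R.
Proof.
apply/funext => i; apply/funext => j.
rewrite /zmul (fsbigTE [fset (i - 1)%R]%fset) => [|k]; last first.
  by rewrite inE /zshift => hk; case: eqP => [hE|]; rewrite ?mul0r//; lia.
by rewrite big_seq_fset1 /zshiftV /zshift /zid subrK eqxx mul1r eq_sym.
Qed.

Lemma zmul_Vshift : (@zshiftV R * @zshift R)%Z2 = @zid R.
Proof.
apply/funext => i; apply/funext => j.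
rewrite /zmul (fsbigTE [fset (i + 1)%R]%fset) => [|k]; last first.
  by rewrite inE /zshiftV /zshift => /negPf ->; rewrite mul0r.
rewrite big_seq_fset1 /zshiftV /zshift /zid eqxx mul1r.
by rewrite (inj_eq (addIr _)).
Qed.

End Banded.

(* Main.v *)
Require Import Defs.
From mathcomp Require Import all_boot all_order all_algebra.
From mathcomp Require Import zify ring.
From mathcomp Require Import boolp classical_sets fsbigop.

(** Everything rests on a local exchange rule between a diagonal matrix, [Psi]
    and a bidiagonal matrix ([diag_Psi_bidiag]): a bidiagonal factor standing to
    the right of D(d) Psi can be pulled out to the left, at the price of
    changing its weights and of leaving a new diagonal matrix to the right of
    [Psi].  The recursion defining the weights of level j + 1 from those of
    level j is exactly this change of weights, with d the diagonal of
    Y_(i-1)^[j] when i > j + 1, and d = 1 when i = j + 1.  In the notation of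
    the iteration,

      Y_(i-1)^[j] Psi M_(2i)^[j] = M_(2i)^[j+1] Psi Y_i^[j]     for i > j + 1,
      Psi M_(2i)^[j] = M_(2i)^[j+1] Psi Y_i^[j]                 for i = j + 1,

    which are [Ymx_Psi_Mmx] and [Psi_Mmx].  Positivity of the weights enters
    only in that the denominators, which are the entries of the Y, are nonzero.

    The factorization of V is then built by induction on the number of factors
    ([Vmx_factor]).  Suppose that the first i factors M_0 Psi, ..., M_(2i-2) Psi
    multiply to

      M_0^[0] ... M_(2i-2)^[i-1] (Psi Y_(i-1)^[i-2] Psi ... Y_(i-1)^[0] Psi)

    and multiply by M_(2i) Psi on the right.  The new bidiagonal factor travels
    leftwards through Y_(i-1)^[0], ..., Y_(i-1)^[i-2] by the first rule,
    gaining a level and turning an index i-1 into i at each crossing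
    ([Wmx_Mmx]), and finally crosses the leftmost [Psi] by the second rule; it
    arrives as M_(2i)^[i], and what it leaves behind is the bracket for i.
    Inserting S^(-n) S^n between the two brackets gives U^(2) L^(2).

    The triangular shapes are a count of bandwidths: S lowers the upper
    bandwidth by 1, its inverse raises it by 1, and Psi and the Y do not change
    it; on the other side each M has one subdiagonal, and n of them are undone
    by S^(-n). *)

Set Implicit Arguments.
Unset Strict Implicit.
Unset Printing Implicit Defensive.

Import Order.TTheory GRing.Theory Num.Theory.

Local Open Scope ring_scope.

(** * Bands *)

Section Bands.
Variable R : realFieldType.
Implicit Types A B C : zmx R.

(** A class of matrices, closed under products, on which the product is
    associative.  The width is quantified away, since associativity does not
    depend on its value. *)
Definition banded A := exists c, lower_banded c A.

Lemma banded_mul A B : banded A -> banded B -> banded (A * B)%Z2.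
Proof. by case=> c hA [d hB]; exists (c + d); apply: lower_banded_mul. Qed.

Lemma banded_exp A k : banded A -> banded (A ^+ k)%Z2.
Proof. by case=> c hA; exists (c *+ k); apply: lower_banded_exp. Qed.

Lemma banded_id : banded (@zid R).
Proof. by exists 0; apply: lower_banded_id. Qed.

Lemma banded_diag (d : int -> R) : banded (zdiag d).
Proof. by exists 0; apply: lower_banded_diag. Qed.

Lemma banded_shift : banded (@zshift R).
Proof. by exists (-1); apply: lower_banded_shift. Qed.

Lemma banded_shiftV : banded (@zshiftV R).
Proof. by exists 1; apply: lower_banded_shiftV. Qed.

Lemma banded_Psi : banded (@zPsi R).
Proof. by exists 0; apply: lower_banded_Psi. Qed.

Lemma banded_big (I : Type) (s : seq I) (F : I -> zmx R) :
  (forall i, banded (F i)) -> banded (\big[@zmul R/@zid R]_(i <- s) F i).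
Proof.
by move=> hF; elim/big_ind: _ => [|A B|i _]; [exact: banded_id|exact: banded_mul|].
Qed.

Lemma banded_mulA A B C : banded A -> banded B -> banded C ->
  (A * (B * C) = A * B * C)%Z2.
Proof. by case=> c hA [d hB] [e hC]; apply: zmulA hA hB hC. Qed.

Lemma lower_banded_big c (I : Type) (s : seq I) (F : I -> zmx R) :
  (forall i, lower_banded c (F i)) ->
  lower_banded (c *+ size s) (\big[@zmul R/@zid R]_(i <- s) F i).
Proof.
move=> hF; elim: s => [|i s IH]; first by rewrite big_nil; apply: lower_banded_id.
by rewrite big_cons /= mulrS; apply: lower_banded_mul.
Qed.

Definition upper_banded (c : int) A := forall i j : int, j + c < i -> A i j = 0.

Lemma upper_banded_mul c d A B :
  upper_banded c A -> upper_banded d B -> upper_banded (c + d) (A * B)%Z2.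
Proof.
move=> hA hB i j hij; apply: fsbig1 => k _.
have [h|h] := ltP (k + c) i; first by rewrite hA ?mul0r.
by rewrite hB ?mulr0//; lia.
Qed.

Lemma upper_banded_id : upper_banded 0 (@zid R).
Proof. by move=> i j hij; rewrite /zid; case: eqP => // hE; lia. Qed.

Lemma upper_banded_exp c A k : upper_banded c A -> upper_banded (c *+ k) (A ^+ k)%Z2.
Proof.
move=> hA; elim: k => [|k IH]; first exact: upper_banded_id.
by rewrite mulrS; apply: upper_banded_mul.
Qed.

Lemma upper_banded_shiftV : upper_banded (-1) (@zshiftV R).
Proof. by move=> i j hij; rewrite /zshiftV /zshift; case: eqP => // hE; lia. Qed.

Lemma upper_banded_big c (I : Type) (s : seq I) (F : I -> zmx R) :
  (forall i, upper_banded c (F i)) ->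
  upper_banded (c *+ size s) (\big[@zmul R/@zid R]_(i <- s) F i).
Proof.
move=> hF; elim: s => [|i s IH]; first by rewrite big_nil; apply: upper_banded_id.
by rewrite big_cons /= mulrS; apply: upper_banded_mul.
Qed.

End Bands.

(** * Entries of the elementary products *)

Section Entries.
Variable R : realFieldType.
Implicit Types (A B : zmx R) (d p q : int -> R).

(** The powers of the shift and the diagonal matrices have a single nonzero
    entry in each row and column; products with them are evaluated by this
    lemma and the next one. *)
Lemma zmul_supp1l A B (i j k : int) :
  (forall l, l != k -> A i l = 0) -> (A * B)%Z2 i j = A i k * B k j.
Proof.
move=> hA; rewrite /zmul (fsbigE [:: k])//=.
  by under eq_bigl do rewrite in_setT; rewrite big_seq1.
by move=> l _; rewrite inE => hl; rewrite hA ?mul0r.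
Qed.

Lemma zmul_supp1r A B (i j k : int) :
  (forall l, l != k -> B l j = 0) -> (A * B)%Z2 i j = A i k * B k j.
Proof.
move=> hB; rewrite /zmul (fsbigE [:: k])//=.
  by under eq_bigl do rewrite in_setT; rewrite big_seq1.
by move=> l _; rewrite inE => hl; rewrite hB ?mulr0.
Qed.

Lemma zmul_diagl d A (i j : int) : (zdiag d * A)%Z2 i j = d i * A i j.
Proof.
rewrite (@zmul_supp1l _ _ _ _ i) /zdiag ?eqxx// => l.
by rewrite eq_sym => /negPf ->.
Qed.

Lemma zmul_diagr d A (i j : int) : (A * zdiag d)%Z2 i j = A i j * d j.
Proof. by rewrite (@zmul_supp1r _ _ _ _ j) /zdiag ?eqxx// => l /negPf ->. Qed.

Lemma zdiag1 : zdiag (fun=> 1) = @zid R.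
Proof.
by apply/funext => i; apply/funext => j; rewrite /zdiag /zid; case: eqP.
Qed.

Lemma zmul1 A : (@zid R * A)%Z2 = A.
Proof. by apply/funext => i; apply/funext => j; rewrite -zdiag1 zmul_diagl mul1r. Qed.

Lemma zmulz1 A : (A * @zid R)%Z2 = A.
Proof. by apply/funext => i; apply/funext => j; rewrite -zdiag1 zmul_diagr mulr1. Qed.

(** The product of all matrices is not associative, so this is not an instance
    of the monoid lemma [big_nat_recr]. *)
Lemma big_zmul_recr n (F : nat -> zmx R) : (forall i, banded (F i)) ->
  \big[@zmul R/@zid R]_(0 <= i < n.+1) F i =
  (\big[@zmul R/@zid R]_(0 <= i < n) F i * F n)%Z2.
Proof.
elim: n F => [|n IH] F hF.
  by rewrite big_nat_recl// !big_geq// zmul1 zmulz1.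
rewrite big_nat_recl// IH// [in RHS]big_nat_recl// banded_mulA//.
exact: banded_big.
Qed.

Lemma zexpS A k : (A ^+ k.+1 = A * A ^+ k)%Z2.
Proof. by []. Qed.

Lemma zexp_shiftE k (i j : int) : (@zshift R ^+ k)%Z2 i j = (i == j + k%:Z)%:R.
Proof.
elim: k i j => [|k IH] i j; first by rewrite addr0.
rewrite zexpS (@zmul_supp1l _ _ _ _ (i - 1)) => [|l hl].
  by rewrite IH /zshift subrK eqxx mul1r; congr (_%:R); lia.
by rewrite /zshift; case: eqP => // hE; lia.
Qed.

Lemma zexp_shiftVE k (i j : int) : (@zshiftV R ^+ k)%Z2 i j = (j == i + k%:Z)%:R.
Proof.
elim: k i j => [|k IH] i j; first by rewrite addr0 eq_sym.
rewrite zexpS (@zmul_supp1l _ _ _ _ (i + 1)) => [|l hl].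
  by rewrite IH /zshiftV /zshift eqxx mul1r; congr (_%:R); lia.
by rewrite /zshiftV /zshift; case: eqP => // hE; lia.
Qed.

Lemma zexp_shiftVK k : (@zshiftV R ^+ k * @zshift R ^+ k)%Z2 = @zid R.
Proof.
apply/funext => i; apply/funext => j; rewrite (@zmul_supp1l _ _ _ _ (i + k%:Z)).
  by rewrite zexp_shiftVE zexp_shiftE eqxx mul1r (inj_eq (addIr _)).
by move=> l /negPf hl; rewrite zexp_shiftVE hl.
Qed.

Lemma zPsiE (i j : int) : @zPsi R i j = (j <= i)%R%:R.
Proof.
rewrite /zPsi; have [hij|hij] := leP j i; last first.
  by apply: fsbig1 => k _; rewrite zexp_shiftE; case: eqP => // hE; lia.
rewrite (fsbigE [:: `|i - j|%N])//=.
  under eq_bigl do rewrite in_setT.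
  by rewrite big_seq1 zexp_shiftE; case: eqP => // hE; lia.
by move=> k _; rewrite inE zexp_shiftE => hk; case: eqP => // hE; lia.
Qed.

Definition bidiag p q : zmx R := (zdiag p + zdiag q * @zshift R)%Z2.

Lemma bidiagE p q (i j : int) :
  bidiag p q i j = (if i == j then p i else 0) + q i * (i == j + 1)%:R.
Proof. by rewrite /bidiag /zadd zmul_diagl. Qed.

Lemma bidiag0 p q (i j : int) : i != j -> i != j + 1 -> bidiag p q i j = 0.
Proof. by rewrite bidiagE => /negPf -> /negPf ->; rewrite mulr0 addr0. Qed.

Lemma lower_banded_bidiag p q : lower_banded 0 (bidiag p q).
Proof.
by move=> i j hij; apply: bidiag0; lia.
Qed.

Lemma upper_banded_bidiag p q : upper_banded 1 (bidiag p q).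
Proof.
by move=> i j hij; apply: bidiag0; lia.
Qed.

Lemma zmul_bidiagl p q A (i j : int) :
  (bidiag p q * A)%Z2 i j = p i * A i j + q i * A (i - 1) j.
Proof.
rewrite /zmul (fsbigE [:: i; i - 1])//=; last 2 first.
- by rewrite inE andbT; lia.
- move=> k _; rewrite !inE negb_or => /andP[h1 h2].
  by rewrite bidiag0 ?mul0r//; lia.
under eq_bigl do rewrite in_setT.
rewrite big_cons big_seq1 !bidiagE subrK !eqxx mulr1.
have -> : (i == i + 1) = false by lia.
have -> : (i == i - 1) = false by lia.
by rewrite mulr0 addr0 add0r.
Qed.

Lemma zmul_bidiagr p q A (i j : int) :
  (A * bidiag p q)%Z2 i j = A i j * p j + A i (j + 1) * q (j + 1).
Proof.
rewrite /zmul (fsbigE [:: j; j + 1])//=; last 2 first.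
- by rewrite inE andbT; lia.
- by move=> k _; rewrite !inE negb_or => /andP[h1 h2]; rewrite bidiag0 ?mulr0.
under eq_bigl do rewrite in_setT.
rewrite big_cons big_seq1 !bidiagE !eqxx mulr1.
have -> : (j == j + 1) = false by lia.
have -> : (j + 1 == j) = false by lia.
by rewrite mulr0 addr0 add0r.
Qed.

(** The exchange rule.  Write y_k = p_k + q_(k+1).  In column j, Psi (D(p) + D(q) S)
    has the entry p_j on the diagonal and the constant y_j below it, so
    multiplying by D(y)^(-1) on the right makes all the entries below the
    diagonal equal to 1 and the diagonal equal to p_j / y_j.  A matrix of the
    form (D(p') + D(q') S) Psi has p'_i on the diagonal and p'_i + q'_i below it
    in row i; hence p'_i = p_i / y_i and q'_i = 1 - p'_i = q_(i+1) / y_i.  The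
    factor D(d) on the left rescales the rows. *)
Lemma diag_Psi_bidiag d p q : (forall k, p k + q (k + 1) != 0) ->
  (zdiag d * (@zPsi R * bidiag p q))%Z2 =
  (bidiag (fun k => p k * (d k / (p k + q (k + 1))))%R
          (fun k => q (k + 1) * (d k / (p k + q (k + 1))))%R *
   (@zPsi R * zdiag (fun k => p k + q (k + 1))%R))%Z2.
Proof.
move=> hy; apply/funext => i; apply/funext => j.
rewrite zmul_diagl zmul_bidiagr zmul_bidiagl !zmul_diagr !zPsiE.
have := hy i; case: (ltgtP i j) => [hij|hij|<-] hi.
- have -> : (j + 1 <= i) = false by lia.
  have -> : (j <= i - 1) = false by lia.
  by rewrite /= !(mul0r, mulr0, addr0).
- have -> : (j + 1 <= i) = true by lia.
  have -> : (j <= i - 1) = true by lia.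
  by rewrite /=; field.
- have -> : (i + 1 <= i) = false by lia.
  have -> : (i <= i - 1) = false by lia.
  by rewrite /=; field.
Qed.

End Entries.

(** * The factorization *)

Section Factorization.
Variable R : realFieldType.
Implicit Types a b : nat -> int -> R.

Local Notation Psi := (@zPsi R).

Lemma weights_gt0 n a b (j i : nat) (k : int) :
  (forall i k, (i < n)%N -> 0 < a i k) -> (forall i k, (i < n)%N -> 0 < b i k) ->
  (j <= i < n)%N -> 0 < (weights a b j).1 i k /\ 0 < (weights a b j).2 i k.
Proof.
move=> ha hb; elim: j i k => [|j IH] i k hi /=; first by split; [apply: ha|apply: hb].
have den_gt0 l : (j <= l < n)%N ->
    0 < (weights a b j).1 l k + (weights a b j).2 l (k + 1).
  by move=> hl; rewrite addr_gt0//; [case: (IH l k)|case: (IH l (k + 1))].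
have [hA _] := IH i k ltac:(lia); have [_ hB] := IH i (k + 1) ltac:(lia).
have hy := den_gt0 i ltac:(lia).
have [hij|hij|hij] := ltngtP j.+1 i; [|lia|].
  by have hy' := den_gt0 i.-1 ltac:(lia); split; rewrite mulr_gt0 ?divr_gt0.
by split; rewrite divr_gt0.
Qed.

Lemma den_neq0 n a b (j i : nat) (k : int) :
  (forall i k, (i < n)%N -> 0 < a i k) -> (forall i k, (i < n)%N -> 0 < b i k) ->
  (j <= i < n)%N -> (weights a b j).1 i k + (weights a b j).2 i (k + 1) != 0.
Proof.
move=> ha hb hi; apply/lt0r_neq0/addr_gt0.
  by case: (weights_gt0 k ha hb hi).
by case: (weights_gt0 (k + 1) ha hb hi).
Qed.

Lemma banded_Mmx a b j i : banded (Mmx a b j i).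
Proof. by exists 0; apply: lower_banded_bidiag. Qed.

Lemma banded_Ymx a b j i : banded (Ymx a b j i).
Proof. exact: banded_diag. Qed.

(** For m = i and preceded by [Psi], this is the middle part of L^(2) for i + 1
    factors; general m is needed to let a bidiagonal matrix cross it one
    diagonal factor at a time. *)
Definition Wmx a b (m i : nat) : zmx R :=
  \big[@zmul R/@zid R]_(0 <= k < m) (Ymx a b (m - 1 - k) i * Psi)%Z2.

Lemma banded_Wmx a b m i : banded (Wmx a b m i).
Proof.
by apply: banded_big => k; apply: banded_mul; [apply: banded_Ymx|apply: banded_Psi].
Qed.

Lemma WmxS a b m i : Wmx a b m.+1 i = (Ymx a b m i * Psi * Wmx a b m i)%Z2.
Proof.
rewrite /Wmx big_nat_recl// subn1 subn0; congr (_ * _)%Z2.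
by apply: eq_bigr => k _; congr (Ymx _ _ _ _ * _)%Z2; lia.
Qed.

Local Hint Resolve banded_mul banded_Mmx banded_Ymx banded_Psi banded_Wmx : banded.

(** [diag_Psi_bidiag] with d the diagonal of Y_i^[j]: the quotient d k / y k is
    the ratio of consecutive denominators in the recursion of the weights. *)
Lemma Ymx_Psi_Mmx n a b (j i : nat) :
  (forall i k, (i < n)%N -> 0 < a i k) -> (forall i k, (i < n)%N -> 0 < b i k) ->
  (j < i < n.-1)%N ->
  (Ymx a b j i * (Psi * Mmx a b j i.+1) =
   Mmx a b j.+1 i.+1 * (Psi * Ymx a b j i.+1))%Z2.
Proof.
move=> ha hb hi; rewrite [LHS]diag_Psi_bidiag => [|k]; last first.
  by apply: (den_neq0 k ha hb); lia.
congr (_ * _)%Z2; rewrite /Mmx -/(bidiag _ _) /=.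
by congr bidiag; apply/funext => k; rewrite ifT//; lia.
Qed.

(** The boundary case of the recursion is [diag_Psi_bidiag] with d = 1. *)
Lemma Psi_Mmx n a b (j : nat) :
  (forall i k, (i < n)%N -> 0 < a i k) -> (forall i k, (i < n)%N -> 0 < b i k) ->
  (j.+1 < n)%N ->
  (Psi * Mmx a b j j.+1 = Mmx a b j.+1 j.+1 * (Psi * Ymx a b j j.+1))%Z2.
Proof.
move=> ha hb hj; rewrite -[LHS]zmul1 -zdiag1 [LHS]diag_Psi_bidiag => [|k]; last first.
  by apply: (den_neq0 k ha hb); lia.
congr (_ * _)%Z2; rewrite /Mmx -/(bidiag _ _) /=.
by congr bidiag; apply/funext => k; rewrite ltnn eqxx mul1r.
Qed.

(** The bidiagonal factor crosses the m diagonal matrices one at a time, from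
    the right.  A trailing [Psi] is carried along so that both sides are
    expressed with [Wmx]: the [Psi] that the crossings leave on the left is
    compensated by the one on the right. *)
Lemma Wmx_Mmx n a b (m i : nat) :
  (forall i k, (i < n)%N -> 0 < a i k) -> (forall i k, (i < n)%N -> 0 < b i k) ->
  (m <= i < n.-1)%N ->
  (Wmx a b m i * (Mmx a b 0 i.+1 * Psi) = Mmx a b m i.+1 * (Psi * Wmx a b m i.+1))%Z2.
Proof.
move=> ha hb; elim: m => [|m IH] hi.
  by rewrite /Wmx !big_geq// zmul1 zmulz1.
rewrite !WmxS -banded_mulA; auto with banded.
rewrite IH ?banded_mulA; auto with banded; last by lia.
rewrite -(banded_mulA _ _ (banded_Mmx _ _ _ _)); auto with banded.
rewrite (Ymx_Psi_Mmx ha hb hi).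
by rewrite !banded_mulA; auto with banded.
Qed.

Lemma Vmx_factor n a b :
  (forall i k, (i < n.+1)%N -> 0 < a i k) -> (forall i k, (i < n.+1)%N -> 0 < b i k) ->
  Vmx n.+1 a b =
  (\big[@zmul R/@zid R]_(0 <= i < n.+1) Mmx a b i i * (Psi * Wmx a b n n))%Z2.
Proof.
elim: n => [|n IH] ha hb.
  by rewrite /Vmx !big_nat_recl// !big_geq// /Wmx big_geq// !zmulz1.
have hU m : banded (\big[@zmul R/@zid R]_(0 <= i < m) Mmx a b i i)%Z2.
  by apply: banded_big => i; apply: banded_Mmx.
have hS := Psi_Mmx ha hb (ltnSn n.+1).
have /(Wmx_Mmx ha hb) hW : (n <= n < n.+2.-1)%N by rewrite leqnn ltnSn.
rewrite /Vmx big_zmul_recr; auto with banded.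
rewrite -/(Vmx n.+1 a b) IH => [|i k hi|i k hi]; [|by apply: ha; lia|by apply: hb; lia].
rewrite [in RHS]big_zmul_recr ?WmxS; auto with banded.
rewrite -!banded_mulA; auto 6 with banded.
(* [hW] carries M_(2n+2) next to the leftmost Psi, at level n, and [hS] makes
   it cross that Psi. *)
rewrite hW (@banded_mulA _ Psi) ?hS; auto with banded.
by rewrite -!banded_mulA; auto 6 with banded.
Qed.

End Factorization.

Theorem lemma6p4 (R : realFieldType) (n : nat) (a b : nat -> int -> R)
    (hn : (1 <= n)%N)
    (ha : forall (i : nat) (j : int), (i < n)%N -> 0 < a i j)
    (hb : forall (i : nat) (j : int), (i < n)%N -> 0 < b i j) :
  lower_triangular (L2mx n a b) /\
  upper_triangular (U2mx n a b) /\
  Gmx n a b = (U2mx n a b * L2mx n a b)%Z2.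
Proof.
split; [|split].
- have hYPsi k : lower_banded 0 (Ymx a b (n - 2 - k) n.-1 * @zPsi R)%Z2.
    rewrite -[0](addr0 0); apply: lower_banded_mul; first exact: lower_banded_diag.
    exact: lower_banded_Psi.
  have hL := lower_banded_mul (lower_banded_mul
      (lower_banded_exp (k := n) (@lower_banded_shift R))
      (lower_banded_mul (@lower_banded_Psi R) (lower_banded_big (s := index_iota 0 n.-1) hYPsi)))
    (lower_banded_exp (k := n) (@lower_banded_shiftV R)).
  by move=> i j hij; apply: hL; rewrite mul0rn; lia.
- have hU := upper_banded_mul
    (upper_banded_big (s := index_iota 0 n)
       (fun i => @upper_banded_bidiag R _ _ : upper_banded 1 (Mmx a b i i)))
    (upper_banded_exp (k := n) (@upper_banded_shiftV R)).
  by move=> i j hij; apply: hU; rewrite size_iota; lia.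
case: n hn ha hb => // n _ ha hb.
rewrite /Gmx Vmx_factor// /U2mx /L2mx -/(Wmx a b n n).
have hU : banded (\big[@zmul R/@zid R]_(0 <= i < n.+1) Mmx a b i i)%Z2.
  by apply: banded_big => i; apply: banded_Mmx.
have hW := banded_mul (@banded_Psi R) (banded_Wmx a b n n).
have hS := banded_exp n.+1 (@banded_shift R).
have hSV := banded_exp n.+1 (@banded_shiftV R).
rewrite -!(banded_mulA hU)//; last by do 2 apply: banded_mul => //.
congr (_ * _)%Z2.
rewrite -(banded_mulA hS hW hSV) (banded_mulA hSV hS (banded_mul hW hSV)).
by rewrite zexp_shiftVK zmul1.
Qed.
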